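(* Let $\mathcal{H}$ be a weighted directed hypernetwork on the node set $C=\{1,2,\dots,n\}$ with hyperedge set $E$. Let $\bowtie$ be a balanced equivalence relation on $C$, let $\mathcal{Q}=\mathcal{H}/{\bowtie}$ be the quotient hypernetwork, and let $\Delta_{\bowtie}=\{x\in V^n:x_i=x_j\text{ whenever }i\bowtie j\}$, identified with $V^p$ where $p$ is the number of $\bowtie$-classes. Then: (i) Any coupled cell system consistent with $\mathcal{H}$, restricted to $\Delta_{\bowtie}$, is a coupled cell system consistent with the quotient hypernetwork $\mathcal{Q}$. (ii) Any coupled cell system consistent with the hypernetwork $\mathcal{Q}$ is the restriction to $\Delta_{\bowtie}$ of a coupled cell system consistent with the hypernetwork $\mathcal{H}$.
   Context: Directed hypergraphs. A directed hypergraph $\mathcal{H}=(C,E)$ consists of a finite set $C=\{1,\dots,n\}$ of nodes (cells) and a finite set $E$ of directed hyperedges; a directed hyperedge is a pair $e=(T(e),H(e))$ where the tail $T(e)$ is a nonempty multiset of elements of $C$ and the head $H(e)$ is a nonempty subset of $C$; $\#T(e)$ is counted with multiplicity. Each $e$ has a real weight $w_e$. All hypergraphs have nonempty node and hyperedge sets and are weakly connected. Hypernetworks. A hypernetwork is a weighted directed hypergraph in which every node has the same phase space $V=\mathbb{R}^d$ and the same (smooth) internal dynamics $f:V\to V$. Let $BS_k(c)=\{e\in E:c\in H(e),\ \#T(e)=k\}$, $BS(c)=\bigcup_kBS_k(c)$, $B(c)=\{k:BS_k(c)\neq\emptyset\}$, $B(\mathcal{H})=\bigcup_cB(c)$. A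 family $Q=(Q_k)_{k\in\mathbb{N}}$ of smooth functions $Q_k:V^{k+1}\to V$, each invariant under permutations of its last $k$ arguments, is admissible if $Q_k\neq0$ for $k\in B(\mathcal{H})$ and $Q_k=0$ otherwise. A coupled cell system consistent with $\mathcal{H}$ is a system $\dot x_i=f(x_i)+\sum_{k\in B(i)}\sum_{e\in BS_k(i)}w_eQ_k(x_i;x_{T(e)})$, $i\in C$, for an admissible family $Q$, where $x_{T(e)}$ lists the variables $x_j$, $j\in T(e)$, with multiplicity. Input equivalence $\sim_I$ on $C$: cells with empty $BS$ are equivalent; cells $c,c'$ with nonempty $BS$ are equivalent iff $B(c)=B(c')$ and $\sum_{e\in BS_k(c)}w_e=\sum_{e\in BS_k(c')}w_e$ for all $k\in B(c)$. Balanced relations. Let $\bowtie$ be an equivalence relation on $C$ with ordered classes $(\overline{c}_1,\dots,\overline{c}_p)$. The pattern determined by $\bowtie$ on $e$ is $\overrightarrow{m}(e)=(m_1,\dots,m_p)$, $m_i$ being the number of elements of $T(e)$ (with multiplicity) in $\overline{c}_i$. For $e\in BS_k(c)$, the weight of the pattern $\overrightarrow{m}(e)$ on $c$ is the sum of the weights of all $e'\in BS_k(c)$ with $\overrightarrow{m}(e')=\overrightarrow{m}(e)$. The relation $\bowtie$ is balanced if it refines $\sim_I$ and, for every $k\in B(\mathcal{H})$ and any two distinct cells $c\bowtie c'$, the set of patterns of hyperedges in $BS_k(c)$ coincides with that of $BS_k(c')$ and each such pattern has the same weight on both cells. Quotient. Standing convention: all hyperedges of $\mathcal{H}$ have heads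 of cardinality one. Let $\bowtie$ be balanced with classes $\overline{C}=(\overline{c}_1,\dots,\overline{c}_p)$. For $e\in E$ with head $\{c\}$ and pattern $\overrightarrow{m}(e)=(m_1,\dots,m_p)$, the projected hyperedge $\overline{e}$ has head $\{\overline{c}\}$ ($\overline{c}$ the class of $c$) and tail the multiset containing each $\overline{c}_i$ exactly $m_i$ times; its weight is the weight of the pattern $\overrightarrow{m}(e)$ on $c$. The quotient $\mathcal{H}/{\bowtie}$ is the hypernetwork with cells $\overline{C}$ (same $V$ and $f$), hyperedges the projected hyperedges, and these weights. *)

(* Defs.v *)
From HB Require Import structures.
From mathcomp Require Import all_boot all_order all_algebra perm.
From mathcomp Require Import finmap multiset.
From mathcomp Require Import boolp reals.
From mathcomp Require Import topology normedtype derive.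

Set Implicit Arguments.
Unset Strict Implicit.
Unset Printing Implicit Defensive.

Import Order.TTheory GRing.Theory Num.Theory.
Import numFieldNormedType.Exports.

Local Open Scope fset_scope.
Local Open Scope mset_scope.
Local Open Scope quotient_scope.
Local Open Scope ring_scope.

Section Smooth.
Context {R : realType} {U W : normedModType R}.

(* C^n maps; between finite-dimensional spaces, the directional derivatives
   are the linear combinations of the partial ones. *)
Fixpoint Cn (n : nat) (f : U -> W) : Prop :=
  if n is n'.+1 then
    (forall x, differentiable f x) /\ (forall v, Cn n' (fun x => 'D_v f x))
  else continuous f.

Definition smooth (f : U -> W) : Prop := forall n, Cn n f.

End Smooth.

HB.instance Definition _ (C : finType) (r : equiv_rel C) :=
  Finite.copy {eq_quot r} (can_type (@EquivQuot.ereprK _ _ _ _ r _)).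

Section Hypergraph.
Variables (R : realType) (C : finType).

Definition hyperedge := ({mset C} * {set C})%type.
Definition tail (e : hyperedge) : {mset C} := e.1.
Definition head (e : hyperedge) : {set C} := e.2.

Definition adjacent (E : {fset hyperedge}) : rel C := fun c c' =>
  has (fun e : hyperedge => ((c \in tail e) || (c \in head e)) &&
                            ((c' \in tail e) || (c' \in head e))) E.

Definition weakly_connected (E : {fset hyperedge}) : Prop :=
  forall c c' : C, connect (adjacent E) c c'.

(* Only the values of [weight] on [edges] are meaningful. *)
Record hypergraph := Hypergraph {
  edges : {fset hyperedge};
  weight : hyperedge -> R;
  nodes_neq0 : (0 < #|C|)%N;
  edges_neq0 : edges != fset0;
  tail_neq0 : forall e, e \in edges -> tail e != mset0;
  head_neq0 : forall e, e \in edges -> head e != set0;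
  edges_connected : weakly_connected edges }.

Variable H : hypergraph.

Definition singleton_heads : Prop := forall e, e \in edges H -> #|head e| = 1%N.

Definition BS (c : C) : {fset hyperedge} := [fset e in edges H | c \in head e].

Definition BS_ (k : nat) (c : C) : {fset hyperedge} :=
  [fset e in edges H | (c \in head e) && (size (tail e) == k)].

(* B(c) = {k | BS_k(c) is nonempty}, as a finite set: see [in_B]. *)
Definition B (c : C) : {fset nat} := [fset size (tail e) | e in BS c].

Lemma in_B k c : (k \in B c) = (BS_ k c != fset0).
Proof.
apply/imfsetP/fset0Pn => /= [[e]|[e]].
  by rewrite !inE /= => /andP[eE ce] ->; exists e; rewrite !inE /= eE ce /=.
rewrite !inE /= => /and3P[eE ce /eqP <-].
by exists e => //; rewrite !inE /= eE.
Qed.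

Definition BH : {fset nat} := (\bigcup_(c in C) B c)%fset.

Definition input_equivalent (c c' : C) : Prop :=
  (BS c = fset0 /\ BS c' = fset0) \/
  [/\ BS c <> fset0, BS c' <> fset0, B c = B c' &
    forall k, k \in B c ->
      \sum_(e <- BS_ k c) weight H e = \sum_(e <- BS_ k c') weight H e].

Variable r : equiv_rel C.

(* Patterns are indexed by the classes themselves, the elements of {eq_quot r},
   rather than by their ranks in some chosen order. *)
Definition pattern (e : hyperedge) : {ffun {eq_quot r} -> nat} :=
  [ffun q => count (fun c => \pi_{eq_quot r} c == q) (tail e)].

Definition pattern_weight (k : nat) (m : {ffun {eq_quot r} -> nat}) (c : C) : R :=
  \sum_(e <- BS_ k c | pattern e == m) weight H e.

Definition balanced : Prop :=
  (forall c c', r c c' -> input_equivalent c c') /\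
  (forall k, k \in BH -> forall c c', c != c' -> r c c' ->
    [fset pattern e | e in BS_ k c] = [fset pattern e | e in BS_ k c'] /\
    (forall m, m \in [fset pattern e | e in BS_ k c] ->
       pattern_weight k m c = pattern_weight k m c')).

End Hypergraph.

Section Quotient.
Variables (R : realType) (C : finType) (H : hypergraph R C) (r : equiv_rel C).

Let Cbar : finType := {eq_quot r}.

Fact mset_of_pattern_key : unit. Proof. exact: tt. Qed.
Definition mset_of_pattern (m : {ffun Cbar -> nat}) : {mset Cbar} :=
  [mset[mset_of_pattern_key] q in [fset q | q : Cbar] => m q].

(* For a head {c}, the projected head is the singleton of the class of c. *)
Definition project (e : hyperedge C) : hyperedge Cbar :=
  (mset_of_pattern (pattern r e), [set \pi_{eq_quot r} c | c in head e]).

Lemma perm_tail_project (e : hyperedge C) :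
  perm_eq (tail (project e)) (map \pi_{eq_quot r} (tail e)).
Proof.
apply/allP => q _ /=.
by rewrite count_mem_mset fsfunE !inE /= ffunE count_map.
Qed.

Lemma tail_projectE (e : hyperedge C) q : tail (project e) q = pattern r e q.
Proof. by rewrite fsfunE !inE. Qed.

Definition quotient_edges : {fset hyperedge Cbar} :=
  [fset project e | e in edges H].

(* The multiplicities of the tail of a projected hyperedge are the pattern it
   comes from, and any c whose class is its head may be used to evaluate the
   weight of that pattern: see [quotient_weightE]. *)
Definition quotient_weight (e : hyperedge Cbar) : R :=
  if [pick c | head e == [set \pi_{eq_quot r} c]] is Some c
  then pattern_weight H (size (tail e)) [ffun q => tail e q] c
  else 0.

Fact quotient_nodes_neq0 : (0 < #|Cbar|)%N.
Proof.
have /card_gt0P[c _] := nodes_neq0 H.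
by apply/card_gt0P; exists (\pi_{eq_quot r} c).
Qed.

Fact quotient_edges_neq0 : quotient_edges != fset0.
Proof.
have /fset0Pn[e eE] := edges_neq0 H.
by apply/fset0Pn; exists (project e); apply/imfsetP; exists e.
Qed.

Fact quotient_tail_neq0 e : e \in quotient_edges -> tail e != mset0.
Proof.
move=> /imfsetP[/= e' /tail_neq0 + ->].
by rewrite -!size_mset_eq0 (perm_size (perm_tail_project e')) size_map.
Qed.

Fact quotient_head_neq0 e : e \in quotient_edges -> head e != finset.set0.
Proof.
move=> /imfsetP[/= e' /head_neq0/finset.set0Pn[c ce] ->].
by apply/finset.set0Pn; exists (\pi_{eq_quot r} c); apply/imsetP; exists c.
Qed.

Fact quotient_connected : weakly_connected quotient_edges.
Proof.
have pP e c : (c \in tail e) || (c \in head e) ->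
    (\pi_{eq_quot r} c \in tail (project e)) ||
    (\pi_{eq_quot r} c \in head (project e)).
  rewrite (perm_mem (perm_tail_project e)).
  by case/orP => ce; rewrite ?(map_f _ ce) //= imset_f ?orbT.
move=> q q'; rewrite -[q]reprK -[q']reprK.
have /connectP[s] := edges_connected H (repr q) (repr q').
elim: s (repr q) => [|c' s IHs] c /= => [_ -> //|/andP[cc' cs] ls].
apply: connect_trans (IHs _ cs ls); apply: connect1.
case/hasP: cc' => e eE /andP[/pP ce /pP c'e].
apply/hasP; exists (project e); first by apply/imfsetP; exists e.
by rewrite ce c'e.
Qed.

Definition quotient : hypergraph R Cbar :=
  Hypergraph quotient_weight quotient_nodes_neq0 quotient_edges_neq0
    quotient_tail_neq0 quotient_head_neq0 quotient_connected.

Lemma quotient_weightE e c : balanced H r ->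
  e \in edges H -> head e = [set c] ->
  weight quotient (project e) =
  pattern_weight H (size (tail e)) (pattern r e) c.
Proof.
move=> [_ bal] eE he; rewrite /= /quotient_weight.
have he' : head (project e) = [set \pi_{eq_quot r} c].
  by rewrite /project /head /= -/(head e) he imset_set1.
have -> : [ffun q => tail (project e) q] = pattern r e.
  by apply/ffunP => q; rewrite ffunE tail_projectE.
rewrite (perm_size (perm_tail_project e)) size_map.
case: pickP => [c'|/(_ c)]; last by rewrite he' eqxx.
rewrite he' => /eqP/set1_inj/eqmodP; have [<- //|cc' rcc'] := eqVneq c c'.
have eBS : e \in BS_ H (size (tail e)) c by rewrite !inE eE he set11 eqxx.
have kB : size (tail e) \in BH H.
  apply/bigfcupP; exists c; first by rewrite mem_index_enum.
  by rewrite in_B; apply/fset0Pn; exists e.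
have [_ weq] := bal _ kB _ _ cc' rcc'.
by rewrite weq //; apply/imfsetP; exists e.
Qed.

End Quotient.

Section Hypernetwork.
Variables (R : realType) (d : nat).

Local Notation V := 'rV[R]_d.

Record hypernetwork (C : finType) := Hypernetwork {
  graph :> hypergraph R C;
  internal : V -> V;
  internal_smooth : smooth internal }.

(* V^(k+1) is V x V^k, with V^k the matrices with k rows. *)
Definition coupling := forall k : nat, V * 'M[R]_(k, d) -> V.

Definition admissible (C : finType) (H : hypergraph R C) (Q : coupling) : Prop :=
  [/\ forall k, smooth (Q k),
      forall k (s : 'S_k) v X, Q k (v, row_perm s X) = Q k (v, X),
      forall k, k \in BH H -> Q k <> (fun=> 0) &
      forall k, k \notin BH H -> Q k = (fun=> 0)].

(* The variables x_j, j in T, when T has k elements; the default c of nth is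
   then irrelevant. *)
Definition tail_vars (C : finType) (x : C -> V) (c : C) (k : nat) (T : {mset C}) :
    'M[R]_(k, d) :=
  \matrix_(l < k) x (nth c T l).

(* A coupled cell system is identified with its vector field on V^C. *)
Definition consistent (C : finType) (N : hypernetwork C)
    (F : (C -> V) -> (C -> V)) : Prop :=
  exists2 Q, admissible N Q &
  forall x i, F x i = internal N (x i) +
    \sum_(k <- B N i) \sum_(e <- BS_ N k i)
      weight N e *: Q k (x i, tail_vars x i k (tail e)).

Variables (C : finType) (r : equiv_rel C).

Definition quotient_network (N : hypernetwork C) : hypernetwork {eq_quot r} :=
  Hypernetwork (quotient N r) (@internal_smooth _ N).

Definition synchronous (x : C -> V) : Prop := forall i j, r i j -> x i = x j.

(* The identification of V^p with the synchrony subspace. *)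
Definition from_classes (y : {eq_quot r} -> V) : C -> V := fun i => y (\pi_{eq_quot r} i).

Lemma from_classes_inj : injective from_classes.
Proof.
move=> y y' yy'; apply/funext => q; rewrite -[q]reprK.
exact: (congr1 (@^~ (repr q)) yy').
Qed.

Lemma synchronousP x : synchronous x <-> exists y, x = from_classes y.
Proof.
split=> [xD|[y ->] i j /eqmodP rij]; last by rewrite /from_classes rij.
exists (fun q => x (repr q)); apply/funext => i.
by apply/xD/eqmodP; rewrite reprK.
Qed.

(* F leaves the synchrony subspace invariant and induces G on it. *)
Definition restricts_to (F : (C -> V) -> (C -> V))
    (G : ({eq_quot r} -> V) -> ({eq_quot r} -> V)) : Prop :=
  forall y, F (from_classes y) = from_classes (G y).

End Hypernetwork.

(* Main.v *)
Require Import Defs.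
From HB Require Import structures.
From mathcomp Require Import all_boot all_order all_algebra perm.
From mathcomp Require Import finmap multiset.
From mathcomp Require Import boolp reals.
From mathcomp Require Import topology normedtype derive.

(** The quotient records exactly the data of the network that a synchronous
    state can see.  Balance says that the projected hyperedges with a tail of
    size [k] entering the class of [c] are the projections of the hyperedges
    with a tail of size [k] entering [c] ([BS_quotient]), whichever
    representative [c] is chosen.  Consequently the network and its quotient
    involve the same tail sizes ([B_quotient], [BH_quotient]), so that they have
    the same admissible families of coupling functions
    ([admissible_quotient]).

    At a synchronous state, a coupling function that is symmetric in its last
    arguments takes the same value on a hyperedge as on its projection
    ([coupling_project]).  Grouping the hyperedges entering [c] by their
    projection, i.e. by their pattern, therefore turns the input received by [c]
    into the input received by its class, because the weight of a projected
    hyperedge is the total weight of its pattern ([sum_inputs_quotient]).  Both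
    directions of the theorem follow by using, for the network and for the
    quotient, one and the same family of coupling functions. *)

Set Implicit Arguments.
Unset Strict Implicit.
Unset Printing Implicit Defensive.

Local Open Scope quotient_scope.
Local Open Scope ring_scope.

Section BalancedQuotient.
Variables (R : realType) (C : finType) (H : hypergraph R C) (r : equiv_rel C).
Hypotheses (hH : singleton_heads H) (hr : balanced H r).

Lemma head_BS k c e : e \in BS_ H k c -> Defs.head e = [set c]%SET.
Proof.
rewrite !inE /= => /and3P[/hH/eqP/cards1P[c' ->]].
by rewrite finset.in_set1 => /eqP ->.
Qed.

Lemma project_eq (e e' : hyperedge C) c c' :
    Defs.head e = [set c]%SET -> Defs.head e' = [set c']%SET ->
    \pi_{eq_quot r} c = \pi_{eq_quot r} c' -> pattern r e = pattern r e' ->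
  project r e = project r e'.
Proof.
by rewrite /project /Defs.head => -> -> cc' ->; rewrite !imset_set1 cc'.
Qed.

Lemma pattern_project (e e' : hyperedge C) :
  project r e = project r e' -> pattern r e = pattern r e'.
Proof. by move=> ee'; apply/ffunP => q; rewrite -!tail_projectE ee'. Qed.

Lemma size_tail_project (e : hyperedge C) :
  size (tail (project r e)) = size (tail e).
Proof. by rewrite (perm_size (perm_tail_project r e)) size_map. Qed.

(** The inclusion from left to right is where balance is needed: a projected
    hyperedge entering the class of [c] may come from a hyperedge entering
    another member of that class, and [c] receives one with the same pattern. *)
Lemma BS_quotient k c :
  BS_ (quotient H r) k (\pi_{eq_quot r} c) =
  [fset project r e | e in BS_ H k c]%fset.
Proof.
apply/fsetP => eb; apply/idP/imfsetP => /= [|[e eBS ->]]; last first.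
  move: (eBS); rewrite !inE /= => /and3P[eE ce ek].
  rewrite size_tail_project ek andbT; apply/andP; split.
    by apply/imfsetP; exists e.
  exact: imset_f.
rewrite !inE /= => /and3P[/imfsetP[/= e eE ->]].
rewrite size_tail_project => /imsetP[c' ce cc' ek].
have eBS : e \in BS_ H k c' by rewrite !inE /= eE ek andbT.
have [eq_cc'|neq_cc'] := eqVneq c' c; first by exists e; rewrite -?eq_cc'.
have kB : k \in BH H.
  apply/bigfcupP; exists c'; first by rewrite mem_index_enum.
  by rewrite in_B; apply/fset0Pn; exists e.
have rcc' : r c' c by apply/eqmodP.
have [pat _] := hr.2 k kB c' c neq_cc' rcc'.
have : pattern r e \in [fset pattern r e | e in BS_ H k c']%fset.
  by apply/imfsetP; exists e.
rewrite pat => /imfsetP[/= e' e'BS ee']; exists e' => //.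
exact: project_eq (head_BS eBS) (head_BS e'BS) (esym cc') ee'.
Qed.

Lemma B_quotient c : B (quotient H r) (\pi_{eq_quot r} c) = B H c.
Proof.
apply/fsetP => k; rewrite !in_B BS_quotient.
apply/fset0Pn/fset0Pn => [[_ /imfsetP[/= e eBS _]]|[e eBS]].
  by exists e.
by exists (project r e); apply/imfsetP; exists e.
Qed.

Lemma BH_quotient : BH (quotient H r) = BH H.
Proof.
apply/fsetP => k; apply/bigfcupP/bigfcupP => [[q _]|[c _]] kB.
  exists (repr q); first by rewrite mem_index_enum.
  by rewrite -B_quotient reprK.
exists (\pi_{eq_quot r} c); first by rewrite mem_index_enum.
by rewrite B_quotient.
Qed.

Lemma admissible_quotient d (Q : coupling R d) :
  admissible (quotient H r) Q <-> admissible H Q.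
Proof. by rewrite /admissible BH_quotient. Qed.

(** Among the hyperedges entering one given cell, having the same pattern and
    having the same projection amount to the same. *)
Lemma weight_project k c e : e \in BS_ H k c ->
  weight (quotient H r) (project r e) =
  \sum_(e' <- BS_ H k c | project r e' == project r e) weight H e'.
Proof.
move=> eBS; have he := head_BS eBS.
have [eE ek] : e \in edges H /\ size (tail e) = k.
  by move: eBS; rewrite !inE /= => /and3P[? _ /eqP].
rewrite (quotient_weightE hr eE he) ek /pattern_weight.
rewrite big_seq_cond [RHS]big_seq_cond; apply: eq_bigl => e'.
apply: andb_id2l => e'BS; apply/eqP/eqP; last exact: pattern_project.
exact: project_eq (head_BS e'BS) he erefl.
Qed.

Section Coupling.
Variables (d k : nat) (Q : 'rV[R]_d * 'M[R]_(k, d) -> 'rV[R]_d).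
Hypothesis Q_sym : forall (s : 'S_k) v X, Q (v, row_perm s X) = Q (v, X).

(** The tail of [project r e] lists the classes of the tail of [e] only up to a
    permutation, which the symmetry of [Q] absorbs. *)
Lemma coupling_project (y : {eq_quot r} -> 'rV[R]_d) v c e :
    size (tail e) = k ->
  Q (v, tail_vars (from_classes y) c k (tail e)) =
  Q (v, tail_vars y (\pi_{eq_quot r} c) k (tail (project r e))).
Proof.
move=> ek; have := perm_tail_project r e.
set t := tail (project r e) => tP.
have sz_t : size t == k by rewrite /t size_tail_project ek.
have sz_m : size (map \pi_{eq_quot r} (tail e)) == k by rewrite size_map ek.
have /tuple_permP[s ts] : perm_eq (Tuple sz_t) (Tuple sz_m) by [].
rewrite -(Q_sym s); congr (Q (_, _)); apply/matrixP => l j.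
rewrite !mxE; congr (y _ _ _).
rewrite -[enum_mset t]/(tval (Tuple sz_t)) ts.
rewrite -tnth_nth tnth_mktuple (tnth_nth (\pi_{eq_quot r} c)) /=.
by rewrite (nth_map c) // ek.
Qed.

Lemma sum_inputs_quotient (y : {eq_quot r} -> 'rV[R]_d) v c :
  \sum_(e <- BS_ H k c)
    weight H e *: Q (v, tail_vars (from_classes y) c k (tail e)) =
  \sum_(e <- BS_ (quotient H r) k (\pi_{eq_quot r} c))
    weight (quotient H r) e *: Q (v, tail_vars y (\pi_{eq_quot r} c) k (tail e)).
Proof.
rewrite BS_quotient (partition_big_imfset _ (project r)).
apply: eq_big_seq => _ /imfsetP[e eBS ->].
rewrite (weight_project eBS) GRing.scaler_suml.
rewrite big_seq_cond [RHS]big_seq_cond; apply: eq_bigr => e' /andP[e'BS /eqP <-].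
have e'k : size (tail e') = k.
  by move: e'BS; rewrite !inE /= => /and3P[_ _ /eqP].
by rewrite coupling_project.
Qed.

End Coupling.
End BalancedQuotient.

(** The vector field that a coupling family determines on a hypernetwork. *)
Definition network_field (R : realType) (d : nat) (C : finType)
    (N : hypernetwork R d C) (Q : coupling R d) (x : C -> 'rV[R]_d) (i : C) :
    'rV[R]_d :=
  internal N (x i) + \sum_(k <- B N i) \sum_(e <- BS_ N k i)
    weight N e *: Q k (x i, tail_vars x i k (tail e)).

Lemma network_field_quotient (R : realType) (d : nat) (C : finType)
    (N : hypernetwork R d C) (r : equiv_rel C) (Q : coupling R d) :
    singleton_heads N -> balanced N r ->
    (forall k (s : 'S_k) v X, Q k (v, row_perm s X) = Q k (v, X)) ->
  restricts_to (network_field N Q) (network_field (quotient_network r N) Q).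
Proof.
move=> hN hr Qs y; apply/funext => i; rewrite /from_classes /network_field.
congr (_ + _); rewrite -(B_quotient hN hr); apply: eq_bigr => k _.
exact: sum_inputs_quotient.
Qed.

Theorem theorem4p17 (R : realType) (d n : nat)
    (N : hypernetwork R d 'I_n) (r : equiv_rel 'I_n)
    (hN : singleton_heads N) (hr : balanced N r) :
  (forall F : ('I_n -> 'rV[R]_d) -> ('I_n -> 'rV[R]_d), consistent N F ->
     exists2 G, consistent (quotient_network r N) G & restricts_to F G) /\
  (forall G : ({eq_quot r} -> 'rV[R]_d) -> ({eq_quot r} -> 'rV[R]_d),
     consistent (quotient_network r N) G ->
     exists2 F, consistent N F & restricts_to F G).
Proof.
have adm Q := admissible_quotient hN hr Q.
split=> [F [Q QN FE]|G [Q /adm QN GE]]; have [_ Qs _ _] := QN.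
  exists (network_field (quotient_network r N) Q).
    by exists Q => //; apply/adm.
  have -> : F = network_field N Q by apply/funext => x; apply/funext => i.
  exact: network_field_quotient.
exists (network_field N Q); first by exists Q.
have -> : G = network_field (quotient_network r N) Q.
  by apply/funext => y; apply/funext => q.
exact: network_field_quotient.
Qed.
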